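(* For any integer $C\ge1$ and any cardinality constraint $k=o(m)$, algorithm $\mathsf{Greedy}$ (with consistent tie-breaking, run for $k'$ iterations) is a $\left(2-\sqrt2-O\!\left(\frac1k+\frac{\ln C}{C}\right)\right)$-approximate randomized composable core-set of multiplicity $C$ and size $k'=(2\sqrt2+1)k$ for any non-negative monotone submodular function $f$ with cardinality constraint $k$.
   Context: $\mathbb N$ is a finite ground set of $n$ items and $f:2^{\mathbb N}\to\mathbb R_{\ge0}$ is monotone ($f(X)\le f(Y)$ for $X\subseteq Y$) and submodular ($f(X\cup\{x\})-f(X)\ge f(Y\cup\{x\})-f(Y)$ for $X\subseteq Y$, $x\notin Y$). $f_k(S)=\max_{S'\subseteq S,|S'|\le k}f(S')$. A random clustering of $\mathbb N$ into $m$ sets with multiplicity $C$ is a family $\{T_1,\dots,T_m\}$ in which each item is independently assigned to $C$ distinct sets chosen uniformly at random. An algorithm $\mathsf{ALG}$ returning $\mathsf{ALG}(T)\subseteq T$, $|\mathsf{ALG}(T)|\le k'$, is an $\alpha$-approximate randomized composable core-set of size $k'$ and multiplicity $C$ if $\mathbb E[f_k(\bigcup_{i=1}^m\mathsf{ALG}(T_i))]\ge\alpha\,\mathbb E[f_k(\bigcup_{i=1}^m T_i)]$. $\mathsf{Greedy}$ with consistent tie-breaking: fix a strict total order on $\mathbb N$; starting from $S=\emptyset$, repeatedly (for $k'$ steps, or until $T$ is exhausted) add the item $x\in T\setminus S$ maximizing $f(S\cup\{x\})-f(S)$, breaking ties by the fixed order. The asymptotic notation is as $k$, $C$, $m$ vary.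 *)

(* Defs.v *)
From HB Require Import structures.
From mathcomp Require Import all_boot all_order all_algebra.
From mathcomp Require Import reals.
From mathcomp Require filter.

Set Implicit Arguments.
Unset Strict Implicit.
Unset Printing Implicit Defensive.

Import Order.TTheory GRing.Theory Num.Theory.

Local Open Scope ring_scope.

Definition nonneg_setfun (R : realType) (N : finType) (f : {set N} -> R) : Prop :=
  forall X : {set N}, 0 <= f X.

Definition monotone_setfun (R : realType) (N : finType) (f : {set N} -> R) : Prop :=
  forall X Y : {set N}, X \subset Y -> f X <= f Y.

Definition marginal (R : realType) (N : finType) (f : {set N} -> R)
  (S : {set N}) (x : N) : R := f (x |: S) - f S.

Definition submodular (R : realType) (N : finType) (f : {set N} -> R) : Prop :=
  forall (X Y : {set N}) (x : N),
    X \subset Y -> x \notin Y -> marginal f Y x <= marginal f X x.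

(* f_k(S); the initial value f set0 is itself one of the competing values, so
   this is exactly the maximum. *)
Definition max_card_le (R : realType) (N : finType) (f : {set N} -> R)
  (k : nat) (S : {set N}) : R :=
  \big[Num.max/f set0]_(S' : {set N} | (S' \subset S) && (#|S'| <= k)%N) f S'.

(* A clustering is encoded by A, where A x is the set of indices of the
   clusters to which the item x is assigned. *)
Definition cluster_at (N : finType) (m : nat) (A : {ffun N -> {set 'I_m}})
  (i : 'I_m) : {set N} := [set x | i \in A x].

(* The A x are independent, each uniform among the C-subsets of 'I_m; these are
   the weights of a probability distribution when C <= m. *)
Definition clustering_pr (R : realType) (N : finType) (C m : nat)
  (A : {ffun N -> {set 'I_m}}) : R :=
  \prod_(x : N) (if #|A x| == C then ('C(m, C)%:R)^-1 else 0).

Definition clustering_expectation (R : realType) (N : finType) (C m : nat)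
  (F : {ffun N -> {set 'I_m}} -> R) : R :=
  \sum_(A : {ffun N -> {set 'I_m}}) clustering_pr R C A * F A.

Definition randomized_composable_coreset (R : realType) (N : finType)
  (f : {set N} -> R) (k k' C m : nat) (ALG : {set N} -> {set N}) (alpha : R) : Prop :=
  (forall T : {set N}, ALG T \subset T /\ (#|ALG T| <= k')%N) /\
  alpha * clustering_expectation C
            (fun A : {ffun N -> {set 'I_m}} =>
               max_card_le f k (\bigcup_(i < m) cluster_at A i))
  <= clustering_expectation C
       (fun A : {ffun N -> {set 'I_m}} =>
          max_card_le f k (\bigcup_(i < m) ALG (cluster_at A i))).

Definition strict_total_order (N : finType) (lt : rel N) : Prop :=
  irreflexive lt /\ transitive lt /\ (forall x y : N, x != y -> lt x y || lt y x).

Definition greedy_choice (R : realType) (N : finType) (f : {set N} -> R)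
  (lt : rel N) (T S : {set N}) (x : N) : bool :=
  (x \in T :\: S) &&
  [forall y in T :\: S, (y != x) ==>
     ((marginal f S y < marginal f S x)
      || ((marginal f S y == marginal f S x) && lt x y))].

(* For a strict total order lt there is exactly one greedy choice unless
   T :\: S is empty, in which case S is left unchanged. *)
Definition greedy_step (R : realType) (N : finType) (f : {set N} -> R)
  (lt : rel N) (T S : {set N}) : {set N} :=
  if [pick x | greedy_choice f lt T S x] is Some x then x |: S else S.

Definition greedy (R : realType) (N : finType) (f : {set N} -> R)
  (lt : rel N) (k' : nat) (T : {set N}) : {set N} :=
  iter k' (greedy_step f lt T) set0.

(* (2 sqrt 2 + 1) k is irrational for k > 0: it is rounded down. *)
Definition coreset_size (R : realType) (k : nat) : nat :=
  Num.truncn ((2 * Num.sqrt 2 + 1) * k%:R : R).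

Notation both_infty := (filter.filter_prod filter.eventually filter.eventually).

(* Main.v *)
(* Fix an optimal set [O], a clustering and a cluster [T_i]. Let [H] be the items
   of [O] selected in some cluster and [L] the items of [O \ H] that greedy would
   reject if they were offered to it together with [T_i].

   Value of [H :|: L]. Let [l = |O \ H|], let [S_j] be the first [j] items greedy
   takes from [T_i], and let [F_j = f (H :|: S_j)]. Each item of [L] loses against
   every item taken, so [l (f S_(j+1) - f S_j) + F_j >= f (H :|: L)]. Summing over
   [j < n] with [n ~ sqrt 2 * l], and bounding [f S_n] by [F_n], gives a lower
   bound on a weighted sum of the increments of [F]; the weights are at most 1 and
   add up to [l] after scaling, so some [l] of the items taken do at least as well.
   Together with [H] they form a set of at most [k] selected items of value at
   least [(2 - sqrt 2) f (H :|: L)].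

   Loss. Condition on the assignment of all items but [x], and let [g] be the
   number of clusters that would select [x]. For a uniformly random [i], the item
   [x] is missing from [H :|: L] only if cluster [i] is one of these [g] while none
   of the [C] clusters receiving [x] is, which has probability
   [(g / m) * C(m - g, C) / C(m, C) <= 1 / (C + 1)]. By submodularity the expected
   value of [H :|: L] is at least [(1 - 1 / (C + 1)) f O]. *)

Require Import Defs.
From HB Require Import structures.
From mathcomp Require Import all_boot all_order all_algebra.
From mathcomp Require Import reals ring lra.
Set Implicit Arguments.
Unset Strict Implicit.
Unset Printing Implicit Defensive.
Import Order.TTheory GRing.Theory Num.Theory.
Local Open Scope ring_scope.

(** * Monotone submodular functions *)

Section SetFunctions.
Variables (R : realType) (N : finType) (f : {set N} -> R).
Hypotheses (f_ge0 : nonneg_setfun f) (f_mono : monotone_setfun f)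
  (f_sub : submodular f).

Lemma marginal_ge0 (S : {set N}) (x : N) : 0 <= marginal f S x.
Proof. by rewrite subr_ge0; apply: f_mono; apply: subsetUr. Qed.

Lemma marginal_le (X Y : {set N}) (x : N) :
  X \subset Y -> marginal f Y x <= marginal f X x.
Proof.
move=> XY; have [xY|xY] := boolP (x \in Y); last exact: f_sub.
by rewrite {1}/marginal (setUidPr _) ?sub1set// subrr marginal_ge0.
Qed.

Lemma gain_le (X Y D : {set N}) :
  X \subset Y -> f (Y :|: D) - f Y <= f (X :|: D) - f X.
Proof.
move=> XY; rewrite -(set_enum D).
elim: (enum D) => [|x s IH]; first by rewrite set_nil !setU0 !subrr.
rewrite set_cons !(setUCA _ [set x]).
have := @marginal_le _ _ x (setSU [set y in s] XY).
by move: IH; rewrite /marginal; lra.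
Qed.

Lemma gain_le_marginals (S L : {set N}) (d : R) :
  (forall x, x \in L -> marginal f S x <= d) ->
  f (S :|: L) - f S <= #|L|%:R * d.
Proof.
rewrite cardE => Ld; have {Ld}: {in enum L, forall x, marginal f S x <= d}.
  by move=> x; rewrite mem_enum; apply: Ld.
rewrite -{2}(set_enum L); elim: (enum L) => [|x s IH] Ld.
  by rewrite set_nil setU0 subrr mul0r.
rewrite set_cons setUCA /= -natr1.
have := @marginal_le _ _ x (subsetUl S [set y in s]).
have := Ld x (mem_head _ _).
have : f (S :|: [set y in s]) - f S <= (size s)%:R * d.
  by apply: IH => y ys; apply: Ld; rewrite inE ys orbT.
by rewrite /marginal; lra.
Qed.

(** Items of [O] enter one at a time. Whenever [M i] contains the new item [x], its gain over
    [M i :&: Q] is at least its marginal over [Q], and this has weight at least [1 - e]. *)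
Lemma expected_value_subset (I : finType) (w : I -> R) (M : I -> {set N})
    (e : R) (O : {set N}) :
  (forall i, 0 <= w i) -> \sum_i w i = 1 -> 0 <= e ->
  (forall x, x \in O -> \sum_(i | x \notin M i) w i <= e) ->
  (1 - e) * f O <= \sum_i w i * f (M i :&: O).
Proof.
move=> w_ge0 w_sum e_ge0; rewrite -(set_enum O) => missed.
have {missed}: {in enum O, forall x, \sum_(i | x \notin M i) w i <= e}.
  by move=> x xO; apply: missed; rewrite inE.
elim: (enum O) => [|x s IH] missed.
  rewrite set_nil; under eq_bigr do rewrite setI0.
  by rewrite -mulr_suml w_sum; have := f_ge0 set0; nra.
rewrite set_cons; set Q := [set y in s] in IH *.
have {}IH : (1 - e) * f Q <= \sum_i w i * f (M i :&: Q).
  by apply: IH => y ys; apply: missed; rewrite inE ys orbT.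
have split_w : \sum_(i | x \in M i) w i = 1 - \sum_(i | x \notin M i) w i.
  by rewrite -w_sum [X in _ = X - _](bigID (fun i => x \in M i)) addrK.
have missed_x : 1 - e <= \sum_(i | x \in M i) w i.
  by rewrite split_w lerD2l lerN2; apply: missed; rewrite mem_head.
apply: (@le_trans _ _ (\sum_i w i * f (M i :&: Q) +
                       (\sum_(i | x \in M i) w i) * marginal f Q x)).
  rewrite (_ : f (x |: Q) = f Q + marginal f Q x); last by rewrite addrC subrK.
  rewrite mulrDr.
  exact: lerD IH (ler_wpM2r (marginal_ge0 Q x) missed_x).
rewrite mulr_suml [X in _ + X]big_mkcond /= -big_split /=; apply: ler_sum => i _.
case: ifP => xM; last first.
  by rewrite addr0 ler_wpM2l//; apply: f_mono; apply: setIS; apply: subsetUr.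
rewrite -mulrDr ler_wpM2l// setIUr.
rewrite (setIidPr (_ : [set x] \subset M i)) ?sub1set//.
by rewrite -lerBrDl; apply: marginal_le; apply: subsetIr.
Qed.

End SetFunctions.

(** * Increments along a growing chain of sets *)

Section Prefixes.
Variables (R : realType) (N : finType) (f : {set N} -> R).
Hypotheses (f_mono : monotone_setfun f) (f_sub : submodular f).
Variable S : nat -> {set N}.
Hypothesis (S_incr : forall j, S j \subset S j.+1).

Lemma increments_sub (n j : nat) : (j < n)%N -> S j.+1 \subset S n.
Proof.
elim: n => // n IH; rewrite ltnS leq_eqVlt => /orP[/eqP->//|/IH /subset_trans].
exact.
Qed.

(** The increments kept so far lie inside [S n], so by submodularity the next one gains at least as
    much over them as over [H :|: S n]. *)
Lemma selected_increments_ge (H : {set N}) (J : pred nat) (n : nat) :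
  f H + \sum_(j < n | J j) (f (H :|: S j.+1) - f (H :|: S j)) <=
  f (H :|: \bigcup_(j < n | J j) (S j.+1 :\: S j)).
Proof.
elim: n => [|n IH]; first by rewrite !big_ord0 addr0 setU0.
rewrite (big_mkcond (fun j : 'I_n.+1 => J j)) big_ord_recr -big_mkcond /=.
rewrite (big_mkcond (fun j : 'I_n.+1 => J j)) big_ord_recr -big_mkcond /=.
case: (J n); last by rewrite addr0 setU0.
set P := \bigcup_(j < n | J j) _ in IH *; rewrite setUA.
have PS : H :|: P \subset H :|: S n.
  apply: setUS; apply/bigcupsP => j _.
  by apply: subset_trans (increments_sub (ltn_ord j)); apply: subsetDl.
have := gain_le f_mono f_sub (S n.+1 :\: S n) PS.
rewrite -[X in f X - _]setUA setDE setUIr setUCr setIT.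
by rewrite (setUidPr (S_incr n)); move: IH; lra.
Qed.

End Prefixes.

(** * The factor-revealing inequality *)

Section Selection.
Variable R : realFieldType.

(** Fractional knapsack: with weights in [0, 1] of total at most [l], nothing beats full weight on a
    best set of at most [l] indices. *)
Lemma top_sum_ge (I : finType) (l : nat) (w d : I -> R) :
  (forall i, 0 <= d i) -> (forall i, 0 <= w i <= 1) -> \sum_i w i <= l%:R ->
  exists2 J : {set I}, (#|J| <= l)%N & \sum_i w i * d i <= \sum_(i in J) d i.
Proof.
move=> d_ge0 w01 w_sum.
have J0 : (#|set0 : {set I}| <= l)%N by rewrite cards0.
have [J J_le J_max] := @arg_maxP _ _ _ set0
  (fun J : {set I} => #|J| <= l)%N (fun J => \sum_(i in J) d i) J0.
exists J => //.
rewrite (bigID (mem J)) /=.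
(* [t] is a price separating [J] from the rest: weight missing inside [J] costs at least [t] per
   unit, weight outside earns at most [t]. It is 0 if [J] has room, otherwise the least [d] on [J];
   for [l = 0] the sum of all [d] serves. *)
suff [t t_in t_out] : exists2 t, (forall i, i \in J -> t <= d i) &
    (forall i, i \notin J -> d i <= t) /\ (t * (l%:R - #|J|%:R) <= 0) /\ 0 <= t.
  case: t_out => t_out [t_card t_ge0].
  have inJ : \sum_(i in J) w i * d i <=
      \sum_(i in J) d i - t * (#|J|%:R - \sum_(i in J) w i).
    rewrite -sum1_card natr_sum -sumrB mulr_sumr -sumrB; apply: ler_sum => i iJ.
    by have := t_in _ iJ; have := w01 i; nra.
  have outJ : \sum_(i | i \notin J) w i * d i <= t * \sum_(i | i \notin J) w i.
    rewrite mulr_sumr; apply: ler_sum => i iJ.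
    by have := t_out _ iJ; have := w01 i; nra.
  by move: w_sum; rewrite (bigID (mem J)) /=; nra.
have [J_lt|l_le] := ltnP #|J| l.
  exists 0; first by [].
  split; last by rewrite mul0r.
  move=> i iJ; have := J_max (i |: J); rewrite cardsU1 iJ big_setU1//= => /(_ J_lt).
  by lra.
have cardJ : #|J| = l by apply/eqP; rewrite eqn_leq J_le.
have [J_eq0|[j0 j0J]] := set_0Vmem J.
  exists (\sum_i d i); first by move=> i; rewrite J_eq0 inE.
  split; last by rewrite cardJ subrr mulr0 sumr_ge0.
  by move=> i _; rewrite (bigD1 i)//= lerDl sumr_ge0.
have [j jJ j_min] := @arg_minP _ _ _ j0 (fun i => i \in J) d j0J.
exists (d j) => //; split; last by rewrite cardJ subrr mulr0.
move=> i iJ; have iJj : i \notin J :\ j by rewrite !inE negb_and iJ orbT.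
have := J_max (i |: J :\ j); rewrite cardsU1 iJj.
rewrite big_setU1//= [X in _ <= X](big_setD1 j jJ) /= lerD2r; apply.
by rewrite -cardJ (cardsD1 j J) jJ.
Qed.

End Selection.

Section FactorRevealing.
Variable R : realType.
Local Notation s := (Num.sqrt (2 : R)).

(** Abel summation: the increment from [F j] to [F j.+1] is counted in [n - 1 - j] of the values. *)
Lemma sum_prefix_values (F : nat -> R) (n : nat) :
  \sum_(j < n) F j =
  n%:R * F 0%N + \sum_(j < n) (n%:R - 1 - j%:R) * (F j.+1 - F j).
Proof.
elim: n => [|n IH]; first by rewrite !big_ord0 mul0r addr0.
have tele : \sum_(j < n) (F j.+1 - F j) = F n - F 0%N.
  rewrite -(big_mkord xpredT (fun j => F j.+1 - F j)).
  by rewrite telescope_sumr.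
rewrite !big_ord_recr /= IH -natr1.
have -> : \sum_(j < n) (n%:R + 1 - 1 - j%:R) * (F j.+1 - F j) =
   \sum_(j < n) (n%:R - 1 - j%:R) * (F j.+1 - F j) + (F n - F 0%N).
  by rewrite -tele -big_split /=; apply: eq_bigr => j _; ring.
by ring.
Qed.

Lemma sqrt2_bounds : [/\ s * s = 2, 1 <= s & s <= 3 / 2].
Proof.
have s2 : s * s = 2 by rewrite -expr2 sqr_sqrtr.
have : 0 <= s by apply: sqrtr_ge0.
by split=> //; nra.
Qed.

(* [F j] stands for the value of [H] with the first [j] greedy items, [D j] for
   the gain of the next one, [V] for the value of [H :|: L] and [b] for the best
   value of a selected set. The bounds on [n] make both [W >= l + n - 1] (weights
   at most 1) and [(2 - s) * Num.max W (l + n) <= n]. *)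
Lemma factor_revealing (l n : nat) (b V : R) (F D : nat -> R) :
  (0 < l)%N -> s * l%:R <= n%:R -> n%:R - 1 <= s * l%:R ->
  0 <= F 0%N -> F 0%N <= b -> (forall j, F j <= F j.+1) ->
  \sum_(j < n) D j <= F n ->
  (forall j, (j < n)%N -> V <= l%:R * D j + F j) ->
  (forall J : {set 'I_n}, (#|J| <= l)%N ->
    F 0%N + \sum_(j in J) (F j.+1 - F j) <= b) ->
  (2 - s) * V <= b.
Proof.
move=> l_gt0 n_ge n_le a_ge0 a_le F_incr D_sum D_ge J_le.
have [ss s_ge1 s_le] := sqrt2_bounds.
have l1 : 1 <= l%:R :> R by rewrite ler1n.
have n1 : 1 <= n%:R :> R by rewrite ler1n -(ltr0n R); nra.
(* [l * W] is the sum of the coefficients [l + n - 1 - j], so dividing these by [W] gives weights of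
   total [l]. *)
pose W : R := n%:R + n%:R * (n%:R - 1) / (2 * l%:R).
have Wl : l%:R * W = l%:R * n%:R + n%:R * (n%:R - 1) / 2.
  by rewrite /W; field; lra.
have W_ge : l%:R + n%:R - 1 <= W.
  by rewrite -(ler_pM2l (_ : 0 < l%:R))// ?Wl; [nra | lra].
have W_gt0 : 0 < W by lra.
have d_ge0 j : 0 <= F j.+1 - F j by rewrite subr_ge0.
pose w (j : 'I_n) : R := (l%:R + n%:R - 1 - j%:R) / W.
have coeff_sum : \sum_(j < n) (l%:R + n%:R - 1 - j%:R : R) = l%:R * W.
  rewrite Wl; elim: (n) => [|p IH]; first by rewrite big_ord0; ring.
  rewrite big_ord_recr /= -natr1.
  rewrite (eq_bigr (fun j : 'I_p => l%:R + p%:R - 1 - j%:R + 1)); last first.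
    by move=> j _; ring.
  by rewrite big_split /= IH sumr_const card_ord; field.
have jn (j : 'I_n) : 0 <= j%:R :> R /\ j%:R + 1 <= n%:R :> R.
  by rewrite natr1 ler_nat ltn_ord ler0n.
have [||J J_card J_ge] := @top_sum_ge R _ l w (fun j => F j.+1 - F j) (fun j => d_ge0 j).
- by move=> j; have [j0 j1] := jn j; rewrite divr_ge0 ?ler_pdivrMr//=; lra.
- by rewrite -mulr_suml coeff_sum mulfK//; lra.
have weighted : \sum_(j < n) (l%:R + n%:R - 1 - j%:R) * (F j.+1 - F j) <= W * (b - F 0%N).
  have -> : \sum_(j < n) (l%:R + n%:R - 1 - j%:R) * (F j.+1 - F j) =
      W * \sum_(j < n) w j * (F j.+1 - F j).
    rewrite mulr_sumr; apply: eq_bigr => j _; rewrite /w; field; lra.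
  rewrite ler_pM2l//; apply: le_trans J_ge _.
  by rewrite lerBrDl; apply: J_le.
have tele : \sum_(j < n) (F j.+1 - F j) = F n - F 0%N.
  by rewrite -(big_mkord xpredT (fun j => F j.+1 - F j)) telescope_sumr.
have summed : n%:R * V <= l%:R * F n + \sum_(j < n) F j.
  apply: (@le_trans _ _ (\sum_(j < n) (l%:R * D j + F j))).
    rewrite mulr_natl -[n in _ *+ n]card_ord -sumr_const; apply: ler_sum => j _.
    exact: D_ge.
  by rewrite big_split /= -mulr_sumr lerD2r ler_wpM2l// ler0n.
have {summed} nV : n%:R * V <= (l%:R + n%:R) * F 0%N + W * (b - F 0%N).
  apply: le_trans summed _; rewrite sum_prefix_values.
  have -> : l%:R * F n = l%:R * F 0%N + \sum_(j < n) l%:R * (F j.+1 - F j).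
    by rewrite -mulr_sumr tele; ring.
  have : \sum_(j < n) l%:R * (F j.+1 - F j) +
      \sum_(j < n) (n%:R - 1 - j%:R) * (F j.+1 - F j) <= W * (b - F 0%N).
    rewrite -big_split /=; apply: le_trans weighted.
    by rewrite le_eqVlt; apply/orP; left; apply/eqP; apply: eq_bigr => j _; ring.
  by lra.
have ssl : s * (s * l%:R) = 2 * l%:R by rewrite mulrA ss.
(* Follows from [n - 1 <= s * l] and [(2 - s) * (1 + s / 2) = 1]. *)
have Wn : (2 - s) * W <= n%:R.
  suff : (2 - s) * (l%:R * W) <= l%:R * n%:R.
    by rewrite mulrCA ler_pM2l//; lra.
  rewrite Wl.
  have h : (2 - s) * (n%:R - 1 : R) <= (2 - s) * (s * l%:R).
    by rewrite ler_wpM2l//; lra.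
  have {h} : (2 - s) * (l%:R + (n%:R - 1) / 2) <= l%:R.
    by move: h ssl; clear; lra.
  by move=> /(ler_wpM2l (ler0n R n)); clear; lra.
(* Follows from [s * l <= n] and [(s - 1) * s = 2 - s]. *)
have ln : (2 - s) * (l%:R + n%:R) <= n%:R.
  have h : (s - 1) * (s * l%:R) <= (s - 1) * n%:R by rewrite ler_wpM2l//; lra.
  by move: h ssl; clear; lra.
have scale X : (2 - s) * X <= n%:R -> n%:R * V <= X * b -> (2 - s) * V <= b.
  move=> X_le nVX; rewrite -(ler_pM2l (_ : 0 < n%:R)); last by lra.
  rewrite mulrCA; apply: le_trans (ler_wpM2l _ nVX) _; first by lra.
  by rewrite mulrA ler_wpM2r// (le_trans a_ge0).
(* In [nV] the nonnegative values [F 0] and [b - F 0] have coefficients [l + n] and [W]; raising the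
   smaller coefficient to the larger leaves a multiple of [b]. *)
have [lnW|/ltW Wln] := leP (l%:R + n%:R) W.
  by apply: scale Wn _; have := ler_wpM2r a_ge0 lnW; lra.
have ba_ge0 : 0 <= b - F 0%N by lra.
by apply: scale ln _; have := ler_wpM2r ba_ge0 Wln; lra.
Qed.

End FactorRevealing.

(** * Greedy *)

Section Greedy.
Variables (R : realType) (N : finType) (f : {set N} -> R) (lt : rel N).
Hypothesis lt_order : strict_total_order lt.

Lemma exists_greedy_choice (T S : {set N}) :
  T :\: S != set0 -> exists x, greedy_choice f lt T S x.
Proof.
have [lt_irr [lt_trans lt_tot]] := lt_order.
case/set0Pn => x0 x0T.
have [x xT x_max] :=
  @arg_maxP _ _ _ x0 (fun x => x \in T :\: S) (marginal f S) x0T.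
pose best := [set y in T :\: S | marginal f S y == marginal f S x].
have x_best : x \in best by rewrite inE xT eqxx.
(* Among tied maximizers, the one with fewest predecessors is the least: a smaller one would have
   strictly fewer. *)
have [y y_best y_min] := @arg_minnP _ x (fun y => y \in best)
  (fun y => #|[set z in best | lt z y]|) x_best.
move: (y_best); rewrite inE => /andP[yT /eqP y_eq].
exists y; rewrite /greedy_choice yT; apply/forall_inP => z zT; apply/implyP => zy.
have := x_max z zT; rewrite y_eq /= le_eqVlt => /orP[z_eq|->//].
apply/orP; right; rewrite z_eq /=.
case/orP: (lt_tot _ _ zy) => // lt_zy.
have z_best : z \in best by rewrite inE zT.
have := y_min z z_best; rewrite leqNgt => /negP[].
apply: proper_card; apply/properP; split.
  apply/subsetP => t; rewrite !inE => /andP[-> tz].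
  exact: lt_trans tz lt_zy.
by exists z; rewrite inE z_best ?lt_zy ?lt_irr.
Qed.

Lemma greedy_choice_inj (T S : {set N}) (x y : N) :
  greedy_choice f lt T S x -> greedy_choice f lt T S y -> x = y.
Proof.
have [lt_irr [lt_trans _]] := lt_order.
move=> /andP[xT /forall_inP x_best] /andP[yT /forall_inP y_best].
apply/eqP/negPn/negP => xy.
have := y_best x xT; have := x_best y yT; rewrite xy eq_sym xy /=.
case: ltgtP => //= _ lt_xy lt_yx.
by have := lt_trans _ _ _ lt_xy lt_yx; rewrite lt_irr.
Qed.

Lemma greedyS (j : nat) (T : {set N}) :
  greedy f lt j.+1 T = greedy_step f lt T (greedy f lt j T).
Proof. by []. Qed.

Lemma greedy_subS (j : nat) (T : {set N}) :
  greedy f lt j T \subset greedy f lt j.+1 T.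
Proof. by rewrite greedyS /greedy_step; case: pickP => // x _; apply: subsetUr. Qed.

Lemma greedy_mono (T : {set N}) (i j : nat) :
  (i <= j)%N -> greedy f lt i T \subset greedy f lt j T.
Proof.
elim: j => [|j IH]; first by rewrite leqn0 => /eqP->.
rewrite leq_eqVlt => /orP[/eqP->//|/IH /subset_trans]; apply.
exact: greedy_subS.
Qed.

Lemma card_greedy_increment (j : nat) (T : {set N}) :
  (#|greedy f lt j.+1 T :\: greedy f lt j T| <= 1)%N.
Proof.
rewrite greedyS /greedy_step; case: pickP => [x _|_]; last first.
  by rewrite setDv cards0.
by rewrite setDUl setDv setU0 (leq_trans (subset_leq_card (subsetDl _ _))) ?cards1.
Qed.

Lemma greedy_sub (j : nat) (T : {set N}) : greedy f lt j T \subset T.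
Proof.
elim: j => [|j IH]; first exact: sub0set.
rewrite greedyS /greedy_step; case: pickP => // x /andP[].
by rewrite inE subUset sub1set IH andbT => /andP[].
Qed.

Lemma card_greedy (j : nat) (T : {set N}) : (#|greedy f lt j T| <= j)%N.
Proof.
elim: j => [|j IH]; first by rewrite cards0.
rewrite -(setID (greedy f lt j.+1 T) (greedy f lt j T)).
apply: leq_trans (leq_card_setU _ _) _; rewrite -[X in (_ <= X)%N]addn1.
apply: leq_add (card_greedy_increment j T).
by apply: leq_trans IH; apply: subset_leq_card; apply: subsetIr.
Qed.

(* Consistency of greedy: offering an item that it would not take changes
   nothing, so each item actually taken has at least the marginal of [x]. *)
Lemma greedy_unselected (k : nat) (T : {set N}) (x : N) :
  x \notin greedy f lt k (x |: T) ->
  forall j, (j < k)%N ->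
    marginal f (greedy f lt j T) x <=
    f (greedy f lt j.+1 T) - f (greedy f lt j T).
Proof.
move=> x_out; set S := greedy f lt ^~ T.
have x_outj j : (j <= k)%N -> x \notin greedy f lt j (x |: T).
  by move=> /(greedy_mono (x |: T)) /subsetP sub; apply: contra x_out => /sub.
(* While the two runs agree, [x] remains a candidate in the larger one, so a choice exists; it is
   not [x], hence it is also the choice from [T]. *)
have step j : (j < k)%N -> greedy f lt j (x |: T) = S j ->
    exists2 y, greedy_choice f lt (x |: T) (S j) y & S j.+1 = y |: S j /\
      greedy f lt j.+1 (x |: T) = y |: S j.
  move=> jk eqS; have xS : x \notin S j by rewrite -eqS; apply: x_outj; apply: ltnW.
  have := x_outj _ jk; rewrite /S !greedyS -/(S j) eqS /greedy_step.
  case: pickP => [y yP|none]; last first.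
    have [|y] := @exists_greedy_choice (x |: T) (S j); last by rewrite none.
    by apply/set0Pn; exists x; rewrite !inE xS eqxx.
  rewrite !inE negb_or => /andP[xy _]; exists y => //; split=> //.
  have yT : greedy_choice f lt T (S j) y.
    move: yP => /andP[]; rewrite !inE eq_sym (negPf xy) /= => yT /forall_inP y_best.
    rewrite /greedy_choice inE yT; apply/forall_inP => z; rewrite inE => /andP[zS zT].
    by apply: y_best; rewrite !inE zS zT orbT.
  case: pickP => [z zT|/(_ y)]; last by rewrite yT.
  by rewrite (greedy_choice_inj zT yT).
have same j : (j <= k)%N -> greedy f lt j (x |: T) = S j.
  elim: j => [//|j IH] jk.
  by have [y _ [-> ->]] := step j jk (IH (ltnW jk)).
move=> j jk; have [y yP [S_next _]] := step j jk (same j (ltnW jk)).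
have xS : x \notin S j by rewrite -same ?x_outj// ltnW.
rewrite -/(S j) -/(S j.+1) S_next -/(marginal f (S j) y).
have [->//|xy] := eqVneq x y.
move: yP => /andP[_ /forall_inP /(_ x)]; rewrite !inE xS eqxx xy /= => /(_ isT).
by case/orP => [/ltW//|/andP[/eqP->]].
Qed.

End Greedy.

(** * From greedy prefixes to a selected set of size at most [k] *)

Section Composition.
Variables (R : realType) (N : finType) (f : {set N} -> R).
Hypotheses (f_ge0 : nonneg_setfun f) (f_mono : monotone_setfun f)
  (f_sub : submodular f).
Local Notation s := (Num.sqrt (2 : R)).

Lemma max_card_le_ge (k : nat) (U S : {set N}) :
  S \subset U -> (#|S| <= k)%N -> f S <= max_card_le f k U.
Proof. by move=> SU Sk; apply: le_bigmax_cond; rewrite SU. Qed.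

(** Each increment has at most one item, so [H] with at most [#|L|] increments has at most [k] items
    and competes in [max_card_le]; this supplies [b] in [factor_revealing]. *)
Lemma prefixes_complete (S : nat -> {set N}) (H L U : {set N}) (k : nat) :
  S 0%N = set0 -> (forall j, S j \subset S j.+1) ->
  (forall j, #|S j.+1 :\: S j| <= 1)%N -> (#|H| + #|L| <= k)%N ->
  (forall j x, (j < coreset_size R k)%N -> x \in L ->
    marginal f (S j) x <= f (S j.+1) - f (S j)) ->
  H :|: S (coreset_size R k) \subset U ->
  (2 - s) * f (H :|: L) <= max_card_le f k U.
Proof.
move=> S0 S_incr S_card HLk L_le; rewrite subUset => /andP[HU SU].
have [ss s_ge1 s_le] := sqrt2_bounds R.
have [L0|l_gt0] := posnP #|L|.
  have -> : L = set0 by apply/eqP; rewrite -cards_eq0 L0.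
  have := @max_card_le_ge k U H HU (leq_trans (leq_addr _ _) HLk).
  by rewrite setU0; have := f_ge0 H; nra.
set l := #|L| in HLk l_gt0 *.
have l1 : 1 <= l%:R :> R by rewrite ler1n.
have sl_ge0 : 0 <= s * l%:R by apply: mulr_ge0; lra.
pose n := (Num.truncn (s * l%:R)).+1.
(* As [1 <= l <= k], [n <= s * l + 1 <= (s + 1) * k]. *)
have n_le : (n <= coreset_size R k)%N.
  have lk : l%:R <= k%:R :> R by rewrite ler_nat (leq_trans _ HLk)// leq_addl.
  rewrite truncn_ge_nat; last by apply: mulr_ge0; lra.
  rewrite -[n%:R]natr1.
  have sl_le : s * l%:R <= s * k%:R by rewrite ler_wpM2l//; lra.
  have : (Num.truncn (s * l%:R))%:R <= s * l%:R by rewrite truncn_le.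
  by move: sl_le sl_ge0 l1 lk; clear; lra.
pose F j := f (H :|: S j).
pose D j := f (S j.+1) - f (S j).
apply: (@factor_revealing R l n _ _ F D) => //.
- by rewrite ltW// truncnS_gt.
- by rewrite -[n%:R]natr1 addrK truncn_le.
- by apply: f_ge0.
- by rewrite /F S0 setU0 max_card_le_ge// (leq_trans (leq_addr _ _) HLk).
- by move=> j; apply: f_mono; apply: setUS.
- rewrite -(big_mkord xpredT D) telescope_sumr// S0.
  by rewrite (le_trans (_ : _ <= f (S n)))// ?gerBl// f_mono// subsetUr.
- move=> j jn.
  have HLD : f (S j :|: L) - f (S j) <= l%:R * D j.
    by apply: gain_le_marginals => // x; apply: L_le; apply: leq_trans n_le.
  have := gain_le f_mono f_sub L (subsetUr H (S j)).
  have : f (H :|: L) <= f (H :|: S j :|: L) by apply: f_mono; rewrite setSU ?subsetUl.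
  by rewrite /F; move: HLD; clear; lra.
move=> J J_card.
pose P := \bigcup_(j < n | j \in J) (S j.+1 :\: S j).
have cardP : (#|P| <= l)%N.
  apply: leq_trans J_card; rewrite -(sum1_card (mem J)).
  apply: (big_ind2 (fun (A : {set N}) p => #|A| <= p)%N) => //.
    by rewrite cards0.
  by move=> A p B q Ap Bq; rewrite (leq_trans (leq_card_setU _ _))// leq_add.
have PU : H :|: P \subset U.
  rewrite subUset HU; apply/bigcupsP => j _; apply: subset_trans SU.
  apply: subset_trans (subsetDl _ _) _; apply: increments_sub => //.
  exact: leq_trans n_le.
apply: le_trans (max_card_le_ge PU _); last first.
  by rewrite (leq_trans (leq_card_setU _ _))// (leq_trans _ HLk)// leq_add.
have := selected_increments_ge f_mono f_sub S_incr H
  (fun j => [exists i : 'I_n, (i \in J) && (val i == j)]) n.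
have eqJ (i : 'I_n) : [exists i0 : 'I_n, (i0 \in J) && (val i0 == i)] = (i \in J).
  apply/existsP/idP => [[i0 /andP[i0J /eqP/val_inj <-]]//|iJ].
  by exists i; rewrite iJ eqxx.
rewrite (eq_bigl _ _ eqJ) [X in f (H :|: X)](eq_bigl _ _ eqJ).
by rewrite /F S0 setU0.
Qed.

End Composition.

(** * Random clusterings *)

Section Clustering.
Variables (R : realType) (N : finType) (C m : nat).
Hypothesis C_le_m : (C <= m)%N.

Definition draw_pr (D : {set 'I_m}) : R := if #|D| == C then ('C(m, C)%:R)^-1 else 0.

Lemma draw_pr_ge0 (D : {set 'I_m}) : 0 <= draw_pr D.
Proof. by rewrite /draw_pr; case: ifP => // _; rewrite invr_ge0 ler0n. Qed.

Lemma sum_draw_pr (P : pred {set 'I_m}) :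
  \sum_(D | P D) draw_pr D = #|[set D | P D & #|D| == C]|%:R / 'C(m, C)%:R.
Proof.
rewrite -big_mkcondr sumr_const mulr_natl; congr (_ *+ _).
by apply: eq_card => D; rewrite inE.
Qed.

Lemma draw_pr_total : \sum_D draw_pr D = 1.
Proof.
rewrite (sum_draw_pr xpredT) /= card_draws card_ord divff//.
by rewrite pnatr_eq0 -lt0n bin_gt0.
Qed.

Lemma clustering_pr_ge0 (A : {ffun N -> {set 'I_m}}) : 0 <= clustering_pr R C A.
Proof. by apply: prodr_ge0 => x _; apply: draw_pr_ge0. Qed.

Lemma clustering_pr_total :
  \sum_(A : {ffun N -> {set 'I_m}}) clustering_pr R C A = 1.
Proof.
rewrite -(bigA_distr_bigA (fun (_ : N) D => draw_pr D)) big1// => x _.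
exact: draw_pr_total.
Qed.

Definition reassign (A : {ffun N -> {set 'I_m}}) (x : N) (D : {set 'I_m}) :
  {ffun N -> {set 'I_m}} := [ffun y => if y == x then D else A y].

Lemma clustering_pr_reassign (A : {ffun N -> {set 'I_m}}) (x : N) (D : {set 'I_m}) :
  clustering_pr R C (reassign A x D) * draw_pr (A x) =
  clustering_pr R C A * draw_pr D.
Proof.
rewrite /clustering_pr (bigD1 x)//= [in RHS](bigD1 x)//= ffunE eqxx.
rewrite (eq_bigr (fun y => draw_pr (A y))); last first.
  by move=> y /negPf yx; rewrite ffunE yx.
by rewrite -/(draw_pr D) -/(draw_pr (A x)); ring.
Qed.

(** Resampling [A x]: exchanging [A x] with a fresh draw [D] is an involution that preserves the
    joint weight. *)
Lemma clustering_expectation_reassign (x : N) (F : {ffun N -> {set 'I_m}} -> R) :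
  clustering_expectation C F =
  clustering_expectation C (fun A => \sum_D draw_pr D * F (reassign A x D)).
Proof.
rewrite /clustering_expectation.
under [RHS]eq_bigr do rewrite big_distrr /=.
rewrite pair_bigA /=.
pose h (p : {ffun N -> {set 'I_m}} * {set 'I_m}) := (reassign p.1 x p.2, p.1 x).
have hK : involutive h.
  case=> A D; rewrite /h /= ffunE eqxx; congr (_, _).
  by apply/ffunP => y; rewrite !ffunE; case: eqP => [->|].
rewrite (reindex_inj (inv_inj hK)) /=.
transitivity (\sum_(p : {ffun N -> {set 'I_m}} * {set 'I_m})
    clustering_pr R C p.1 * F p.1 * draw_pr p.2).
  rewrite -(pair_bigA _ (fun A D => clustering_pr R C A * F A * draw_pr D)) /=.
  by apply: eq_bigr => A _; rewrite -mulr_sumr draw_pr_total mulr1.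
apply: eq_bigr => -[A D] _ /=.
have -> : reassign (reassign A x D) x (A x) = A by have [] := hK (A, D).
by rewrite mulrA clustering_pr_reassign; ring.
Qed.

(* [g C(m - g, C)] counts the [(C + 1)]-sets meeting [G] in one point, of which
   there are at most [C(m, C + 1) <= m C(m, C) / (C + 1)]. *)
Lemma draw_misses_le (G : {set 'I_m}) :
  #|G|%:R * \sum_(D : {set 'I_m} | [disjoint D & G]) draw_pr D <= m%:R / C.+1%:R.
Proof.
rewrite sum_draw_pr.
have -> : #|[set D : {set 'I_m} | [disjoint D & G] & #|D| == C]| = 'C(m - #|G|, C).
  have -> : (m - #|G|)%N = #|~: G| by rewrite [RHS]cardsCs setCK card_ord.
  rewrite -cards_draws.
  by apply: eq_card => D; rewrite !inE disjoints_subset.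
have G_le : (#|G| <= m)%N by rewrite -[X in (_ <= X)%N](card_ord m) max_card.
(* The term of index 1 in Vandermonde's identity for [#|G| + (m - #|G|)]. *)
have one_point : (#|G| * 'C(m - #|G|, C) <= 'C(m, C.+1))%N.
  rewrite -[X in (_ <= 'C(X, _))%N](subnKC G_le) -binomial.Vandermonde.
  rewrite (bigD1 (Ordinal (isT : 1 < C.+2)%N))//= bin1 subn1 /=.
  exact: leq_addr.
have count : (#|G| * 'C(m - #|G|, C) * C.+1 <= m * 'C(m, C))%N.
  apply: leq_trans (leq_mul one_point (leqnn _)) _.
  by rewrite mulnC mul_bin_left leq_mul// leq_subr.
rewrite mulrA ler_pdivlMr// mulrAC ler_pdivrMr ?ltr0n ?bin_gt0//.
by rewrite -!natrM ler_nat.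
Qed.

Lemma all_clusters_miss_le (x : N) (G : {ffun N -> {set 'I_m}} -> {set 'I_m}) :
  (forall A D, G (reassign A x D) = G A) ->
  clustering_expectation C (fun A => #|G A|%:R * [disjoint A x & G A]%:R) <=
  m%:R / C.+1%:R :> R.
Proof.
move=> G_indep; rewrite (clustering_expectation_reassign x).
rewrite -[leRHS]mul1r -[X in _ <= X * _]clustering_pr_total mulr_suml.
apply: ler_sum => A _.
apply: ler_wpM2l; first exact: clustering_pr_ge0.
apply: le_trans (draw_misses_le (G A)).
rewrite mulr_sumr [leRHS]big_mkcond /=; apply: ler_sum => D _.
rewrite G_indep ffunE eqxx.
by case: ifP => _; rewrite ?mulr0 ?mulr1 ?mulr0// mulrC.
Qed.

End Clustering.

(** * Expected value of the greedy core-set *)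

Section Coreset.
Variables (R : realType) (N : finType) (f : {set N} -> R).
Hypotheses (f_ge0 : nonneg_setfun f) (f_mono : monotone_setfun f)
  (f_sub : submodular f).
Local Notation s := (Num.sqrt (2 : R)).

Lemma max_card_leP (k : nat) (U : {set N}) :
  exists2 S : {set N}, (S \subset U) && (#|S| <= k)%N & max_card_le f k U = f S.
Proof.
have P0 : ((set0 : {set N}) \subset U) && (#|(set0 : {set N})| <= k)%N.
  by rewrite sub0set cards0.
have f0_le (S : {set N}) : (S \subset U) && (#|S| <= k)%N -> f set0 <= f S.
  by move=> _; apply: f_mono; apply: sub0set.
by have [S] := @eq_bigmax _ _ _ _ set0 _ f P0 f0_le; exists S.
Qed.

Lemma max_card_le_mono (k : nat) (U V : {set N}) :
  U \subset V -> max_card_le f k U <= max_card_le f k V.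
Proof.
move=> UV; have [S /andP[SU Sk] ->] := max_card_leP k U.
by apply: max_card_le_ge => //; apply: subset_trans UV.
Qed.

Variables (C m k : nat) (lt : rel N).
Hypotheses (C_gt0 : (0 < C)%N) (C_le_m : (C <= m)%N) (lt_order : strict_total_order lt).
Local Notation k' := (coreset_size R k).
Local Notation clustering := {ffun N -> {set 'I_m}}.
Local Notation alg := (greedy f lt k').

Let selected (A : clustering) := \bigcup_(i < m) alg (cluster_at A i).
Let wins (A : clustering) (x : N) := [set i | x \in alg (x |: cluster_at A i)].

(** A cluster that already contains [x] is unchanged when [x] is offered, so winning there means
    being selected. *)
Lemma unselected_disjoint_wins (A : clustering) (x : N) :
  x \notin selected A -> [disjoint A x & wins A x].
Proof.
move=> x_out; apply/pred0P => i /=; apply/negP => /andP[iAx]; rewrite inE => xi.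
case/negP: x_out; apply/bigcupP; exists i => //.
by move: xi; rewrite (setUidPr _)// sub1set inE.
Qed.

(* The part of [O] that is either selected somewhere or would be rejected by
   the [i]-th cluster: an item of [O] is lost only if the [i]-th cluster wins it
   while it is assigned to no winning cluster. *)
Let covered (O : {set N}) (A : clustering) (i : 'I_m) :=
  (O :&: selected A) :|: [set x in O :\: selected A | i \notin wins A x].

Lemma covered_value_le (O : {set N}) (A : clustering) (i : 'I_m) :
  (#|O| <= k)%N -> (2 - s) * f (covered O A i) <= max_card_le f k (selected A).
Proof.
move=> Ok; apply: (prefixes_complete f_ge0 f_mono f_sub
  (S := fun j => greedy f lt j (cluster_at A i))) => //.
- by move=> j; apply: greedy_subS.
- by move=> j; apply: card_greedy_increment.
- apply: leq_trans Ok; rewrite -(cardsID (selected A) O) leq_add2l.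
  by apply: subset_leq_card; apply/subsetP => x; rewrite inE => /andP[].
- move=> j x jk'; rewrite !inE => /andP[_ x_out].
  exact: (greedy_unselected lt_order x_out).
by rewrite subUset subsetIr; apply: (bigcup_sup i).
Qed.

Lemma covered_expectation_ge (O : {set N}) :
  (1 - C.+1%:R^-1) * f O <=
  \sum_(p : clustering * 'I_m) clustering_pr R C p.1 / m%:R * f (covered O p.1 p.2).
Proof.
have m_gt0 : 0 < m%:R :> R by rewrite ltr0n (leq_trans C_gt0).
rewrite [leRHS](eq_bigr (fun p => clustering_pr R C p.1 / m%:R *
    f (covered O p.1 p.2 :&: O))); last first.
  move=> p _; congr (_ * f _); apply/esym/setIidPl/subsetP => x.
  by rewrite !inE => /orP[/andP[]|/andP[/andP[]]].
apply: expected_value_subset => //.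
- by move=> p; rewrite divr_ge0 ?clustering_pr_ge0 ?ler0n.
- rewrite -(pair_bigA _ (fun A (i : 'I_m) => clustering_pr R C A / m%:R)) /=.
  rewrite -[RHS](clustering_pr_total R N C_le_m); apply: eq_bigr => A _.
  by rewrite sumr_const card_ord -[LHS]mulr_natr divfK// lt0r_neq0.
- by rewrite invr_ge0 ler0n.
move=> x xO.
(* [wins] adds [x] to every cluster before running greedy, so the assignment of [x] itself has no
   influence. *)
have reassigned A D : wins (reassign A x D) x = wins A x.
  apply/setP => i; rewrite !inE; congr (_ \in alg _).
  by apply/setP => y; rewrite !inE ffunE; case: eqP.
have := all_clusters_miss_le R C_le_m reassigned.
rewrite /clustering_expectation -ler_pdivrMl//.
apply: le_trans; rewrite big_mkcond /=.
rewrite -(pair_bigA _ (fun A (i : 'I_m) =>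
  if x \notin covered O A i then clustering_pr R C A / m%:R else 0)) /=.
rewrite mulr_sumr; apply: ler_sum => A _.
have w_ge0 : 0 <= clustering_pr R C A / m%:R.
  by rewrite divr_ge0 ?clustering_pr_ge0 ?ler0n.
rewrite [leRHS]mulrCA [leRHS]mulrA; have [dis|meet] := boolP [disjoint A x & wins A x].
  rewrite mulr1 mulr_natr -sumr_const big_mkcond [leRHS]big_mkcond /=.
  apply: ler_sum => i _; rewrite !inE xO.
  by case: ifP => //; rewrite /= ?andbT; case: ifP => //; case: (x \in selected A).
rewrite mulr0 mulr0 big1// => i _; rewrite !inE xO /=.
suff -> : x \in selected A by [].
by apply: contraR meet; apply: unselected_disjoint_wins.
Qed.

Lemma greedy_coreset :
  randomized_composable_coreset f k k' C m alg (2 - s - (2 - s) / C.+1%:R).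
Proof.
have m_gt0 : 0 < m%:R :> R by rewrite ltr0n (leq_trans C_gt0).
have [_ s_ge1 s_le] := sqrt2_bounds R.
split; first by move=> T; rewrite greedy_sub card_greedy.
(* [O] is optimal in the whole ground set, hence fixed before the clustering is drawn. *)
have [O /andP[_ Ok] O_opt] := max_card_leP k setT.
have opt_le : clustering_expectation C (fun A : clustering =>
    max_card_le f k (\bigcup_(i < m) cluster_at A i)) <= f O.
  rewrite -[leRHS]mul1r -[X in _ <= X * _](clustering_pr_total R N C_le_m) mulr_suml.
  apply: ler_sum => A _; apply: ler_wpM2l; first exact: clustering_pr_ge0.
  by rewrite -O_opt; apply: max_card_le_mono; apply: subsetT.
have inv_le1 : C.+1%:R^-1 <= 1 :> R by rewrite invf_le1 ?ler1n ?ltr0n.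
have -> : 2 - s - (2 - s) / C.+1%:R = (2 - s) * (1 - C.+1%:R^-1) by ring.
apply: le_trans (ler_wpM2l _ opt_le) _; first by rewrite mulr_ge0 ?subr_ge0//; lra.
rewrite -mulrA; apply: le_trans (ler_wpM2l _ (covered_expectation_ge O)) _.
  by lra.
rewrite mulr_sumr.
rewrite -(pair_bigA _ (fun A i =>
  (2 - s) * (clustering_pr R C A / m%:R * f (covered O A i)))) /=.
apply: ler_sum => A _.
apply: (@le_trans _ _ (\sum_(i < m)
    clustering_pr R C A / m%:R * max_card_le f k (selected A))).
  apply: ler_sum => i _; rewrite mulrCA ler_wpM2l ?covered_value_le//.
  by rewrite divr_ge0 ?clustering_pr_ge0 ?ler0n.
by rewrite sumr_const card_ord -[leLHS]mulr_natr mulrAC divfK ?lt0r_neq0.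
Qed.

End Coreset.

(* Asymptotic form of the guarantee *)
From mathcomp Require Import all_classical all_reals all_analysis.
Import numFieldNormedType.Exports.
Local Open Scope classical_set_scope.
Local Open Scope ring_scope.

Lemma inv_le_ln_div (R : realType) (C : nat) :
  (2 <= C)%N -> C%:R^-1 <= (ln 2)^-1 * (ln C%:R / C%:R) :> R.
Proof.
move=> C2; have ln2_gt0 : 0 < ln (2 : R) by rewrite ln_gt0// ltr1n.
have ln_le : ln (2 : R) <= ln C%:R.
  by rewrite ler_ln ?posrE ?ltr0n ?ler_nat// (leq_trans _ C2).
rewrite mulrA -[leLHS]mul1r ler_wpM2r ?invr_ge0 ?ler0n//.
by rewrite mulrC ler_pdivlMr// mul1r.
Qed.

(* The error term err k C is an absolute function of k and C: it depends neither
   on the sequence k nor on m, the ground set, f or the tie-breaking order. The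
   O is the usual one, for k and C tending to infinity. *)
Theorem theorem5 (R : realType) :
  exists err : nat -> nat -> R,
    ((fun kC : nat * nat => err kC.1 kC.2 : R^o)
       =O_both_infty
     (fun kC : nat * nat => kC.1%:R^-1 + ln kC.2%:R / kC.2%:R : R^o)) /\
    forall k : nat -> nat,
      (fun m : nat => (k m)%:R : R^o) =o_\oo (fun m : nat => m%:R : R^o) ->
      \forall m \near \oo,
        forall C : nat, (1 <= C <= m)%N ->
        forall (N : finType) (f : {set N} -> R) (lt : rel N),
          nonneg_setfun f -> monotone_setfun f -> submodular f ->
          strict_total_order lt ->
          randomized_composable_coreset f (k m) (coreset_size R (k m)) C m
            (greedy f lt (coreset_size R (k m)))
            (2 - Num.sqrt 2 - err (k m) C).
Proof.
exists (fun _ C => (2 - Num.sqrt 2) / C.+1%:R); split; last first.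
  move=> k _; apply: nearW => m C /andP[C_gt0 C_le_m] N f lt f_ge0 f_mono f_sub lt_ord.
  exact: greedy_coreset.
have [_ s_ge1 s_le] := sqrt2_bounds R.
have ln2_gt0 : 0 < ln (2 : R) by rewrite ln_gt0// ltr1n.
apply/eqO_exP; exists (ln 2)^-1; first by rewrite invr_gt0.
(* [C = 1] is excluded because [ln 1 = 0]; from 2 on, [1 / C] is at most [ln C / C] divided by
   [ln 2]. *)
exists (setT, [set C | (2 <= C)%N]) => /=.
  by split; [exact: filterT | exact: nbhs_infty_ge].
move=> [k C] [_ /= C2].
have C_gt0 : 0 < C%:R :> R by rewrite ltr0n (leq_trans _ C2).
have lnC_ge0 : 0 <= ln C%:R / C%:R :> R.
  by rewrite divr_ge0 ?ler0n// ln_ge0// ler1n (leq_trans _ C2).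
rewrite !ger0_norm; last 2 first.
- by rewrite addr_ge0// invr_ge0 ler0n.
- by rewrite divr_ge0 ?ler0n//; lra.
apply: (@le_trans _ _ C%:R^-1).
  rewrite -[leRHS]mul1r ler_pM ?invr_ge0 ?ler0n//; [lra|lra|].
  by rewrite lef_pV2 ?posrE ?ler_nat ?ltr0Sn.
apply: le_trans (inv_le_ln_div R C2) _.
by rewrite ler_wpM2l ?invr_ge0 ?(ltW ln2_gt0)// lerDr invr_ge0 ler0n.
Qed.
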